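(* Let $n,b,d$ be nonnegative integers. Then \[\sum_{k=0}^n \binom{n}{k}^2\frac{\binom{n+bn}{k}\binom{n+dn}{k}}{\binom{k+bn}{k}\binom{k+dn}{k}}\Big\{1+(n-2k)\big(2H_k+H_{bn+k}+H_{dn+k}\big)\Big\} = (-1)^n\frac{\binom{2n+bn+dn}{n}}{\binom{n+bn}{n}\binom{n+dn}{n}}.\]
   Context: $H_0=0$ and $H_m=\sum_{j=1}^m \frac{1}{j}$ for positive integers $m$ (classical harmonic numbers). *)

(* Defs.v *)
From mathcomp Require Import all_boot all_order all_algebra.

Set Implicit Arguments.
Unset Strict Implicit.
Unset Printing Implicit Defensive.

Import GRing.Theory Num.Theory.

Local Open Scope ring_scope.

Definition harmonic (m : nat) : rat := \sum_(1 <= j < m.+1) (j%:R)^-1.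

(* Main.v *)
(** With [p = b n] and [q = d n] treated as independent of [n], the summand is, after
    symmetrisation under [k -> n - k] and up to a factor depending on [n, p, q] only,
    the derivative at [x = k] of
      [(n - 2 x) / (x!^2 (p+x)! (q+x)! (n-x)!^2 (p+n-x)! (q+n-x)!)].
    This very-well-poised term has a first-order WZ recurrence in [n] with a polynomial
    certificate; it is an identity in [x], so it can be differentiated, and the boundary
    terms vanish because [1/(x-1)!^2] and [1/(n-x)!^2] have double zeros at [x = 0] and
    [x = n + 1].  Induction on [n] then gives the closed form. *)
Require Import Defs.
From mathcomp Require Import all_boot all_order all_algebra.
From mathcomp Require Import ring zify.

Import GRing.Theory Num.Theory.

Local Open Scope ring_scope.

Lemma harmonicS m : harmonic m.+1 = harmonic m + (m.+1%:R)^-1.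
Proof. by rewrite /harmonic big_nat_recr. Qed.

Lemma fact_neq0 m : m`!%:R != 0 :> rat.
Proof. by rewrite pnatr_eq0 -lt0n fact_gt0. Qed.

Lemma bin_factr m k : (k <= m)%N ->
  'C(m, k)%:R = m`!%:R / (k`!%:R * (m - k)`!%:R) :> rat.
Proof.
move=> le_km; apply: (canRL (mulfK _)); first by rewrite mulf_neq0 ?fact_neq0.
by rewrite -!natrM bin_fact.
Qed.

Definition quartic (p q x : rat) := x ^+ 2 * (p + x) * (q + x).

Definition quartic' (p q x : rat) :=
  2 * x * (p + x) * (q + x) + x ^+ 2 * (2 * x + p + q).

Definition inv_fact4 (p q k : nat) : rat :=
  (k`!%:R ^+ 2 * (p + k)`!%:R * (q + k)`!%:R)^-1.

Definition harmonic4 (p q k : nat) : rat :=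
  2 * harmonic k + harmonic (p + k) + harmonic (q + k).

Lemma inv_fact4S p q k :
  inv_fact4 p q k = quartic p%:R q%:R k.+1%:R * inv_fact4 p q k.+1.
Proof.
rewrite /inv_fact4 /quartic !addnS !factS !natrM -!natrD !addnS.
by field; rewrite !fact_neq0 !nat1r !pnatr_eq0 /= -?natrD ?nat1r ?pnatr_eq0.
Qed.

(** This is the logarithmic derivative of the recurrence [inv_fact4S], multiplied through by
    [quartic] to avoid division. *)
Lemma harmonic4S p q k :
  quartic p%:R q%:R k.+1%:R * harmonic4 p q k.+1 =
  quartic p%:R q%:R k.+1%:R * harmonic4 p q k + quartic' p%:R q%:R k.+1%:R.
Proof.
rewrite /harmonic4 /quartic /quartic' !addnS !harmonicS -!addnS !natrD.
by field; rewrite !nat1r -!natrD ?nat1r !pnatr_eq0 /= ?addnS.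
Qed.

(* The derivative at [x = k] of [Q(x) / (x!^2 (p+x)! (q+x)! (n-x)!^2 (p+n-x)! (q+n-x)!)],
   given [v = Q(k)] and [v' = Q'(k)]; the Euler constants of the four digamma terms at
   [k] and at [n - k] cancel. *)
Definition dterm p q n k (v v' : rat) :=
  inv_fact4 p q k * inv_fact4 p q (n - k)
  * (v' - v * (harmonic4 p q k - harmonic4 p q (n - k))).

Lemma dtermD p q n k u u' v v' :
  dterm p q n k (u + v) (u' + v') = dterm p q n k u u' + dterm p q n k v v'.
Proof. by rewrite /dterm; ring. Qed.

Lemma dtermB p q n k u u' v v' :
  dterm p q n k (u - v) (u' - v') = dterm p q n k u u' - dterm p q n k v v'.
Proof. by rewrite /dterm; ring. Qed.

Lemma dtermZ p q n k c v v' :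
  dterm p q n k (c * v) (c * v') = c * dterm p q n k v v'.
Proof. by rewrite /dterm; ring. Qed.

(** Passing from [n] to [n.+1] at fixed [x] costs the factor [quartic] at [n + 1 - x]; the product
    rule gives the new derivative, with a minus sign because this argument decreases in [x]. *)
Lemma dterm_up p q n k v v' : (k <= n)%N ->
  let y := (n.+1 - k)%:R in
  dterm p q n k v v' =
  dterm p q n.+1 k (v * quartic p%:R q%:R y)
    (v' * quartic p%:R q%:R y - v * quartic' p%:R q%:R y).
Proof.
move=> le_kn /=; rewrite /dterm subSn // (inv_fact4S p q (n - k)).
have := harmonic4S p q (n - k); move: (quartic _ _ _) (quartic' _ _ _) => A A' hS.
have -> : A' = A * harmonic4 p q (n - k).+1 - A * harmonic4 p q (n - k).
  by rewrite hS; ring.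
by ring.
Qed.

Lemma dterm_upS p q n k v v' :
  let y := k.+1%:R in
  dterm p q n k v v' =
  dterm p q n.+1 k.+1 (v * quartic p%:R q%:R y)
    (v' * quartic p%:R q%:R y + v * quartic' p%:R q%:R y).
Proof.
rewrite /= /dterm subSS (inv_fact4S p q k).
have := harmonic4S p q k; move: (quartic _ _ _) (quartic' _ _ _) => A A' hS.
have -> : A' = A * harmonic4 p q k.+1 - A * harmonic4 p q k by rewrite hS; ring.
by ring.
Qed.

Lemma sum_dterm_up p q n (v v' : nat -> rat) :
  \sum_(0 <= k < n.+1) dterm p q n k (v k) (v' k) =
  \sum_(0 <= k < n.+2)
     dterm p q n.+1 k (v k * quartic p%:R q%:R (n.+1%:R - k%:R))
       (v' k * quartic p%:R q%:R (n.+1%:R - k%:R)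
        - v k * quartic' p%:R q%:R (n.+1%:R - k%:R)).
Proof.
rewrite [RHS]big_nat_recr //= subrr.
(* The double root of [quartic] at 0 kills both the value and the derivative. *)
rewrite [X in _ + X](_ : _ = 0); last by rewrite /dterm /quartic /quartic'; ring.
rewrite addr0 !big_nat; apply: eq_bigr => k /andP[_ lt_kn].
by rewrite dterm_up // natrB // ltnW.
Qed.

Lemma sum_dterm_upS p q n (v v' : nat -> rat) :
  \sum_(0 <= k < n.+1) dterm p q n k (v k.+1) (v' k.+1) =
  \sum_(0 <= k < n.+2)
     dterm p q n.+1 k (v k * quartic p%:R q%:R k%:R)
       (v' k * quartic p%:R q%:R k%:R + v k * quartic' p%:R q%:R k%:R).
Proof.
rewrite [RHS]big_nat_recl //=.
rewrite [X in X + _](_ : _ = 0); last by rewrite /dterm /quartic /quartic'; ring.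
by rewrite add0r; apply: eq_bigr => k _; rewrite dterm_upS.
Qed.

(* [cert] is determined by requiring that the odd part in [s] of [cert * quartic] be a
   multiple of [s], where [s = x - m] is centred at [m = (n + 1) / 2]; [e1, e2, e3] are
   the elementary symmetric functions of [m, m, m + p, m + q]. *)
Definition e1 (m p q : rat) := 4 * m + p + q.

Definition cert (m p q x : rat) :=
  let e2 := m ^+ 2 + 2 * m * (2 * m + p + q) + (m + p) * (m + q) in
  let e3 := m ^+ 2 * (2 * m + p + q) + 2 * m * (m + p) * (m + q) in
  - e1 m p q * (x - m) ^+ 2 + e1 m p q ^+ 2 * (x - m) + (e3 - e1 m p q * e2).

Definition cert' (m p q x : rat) := - 2 * e1 m p q * (x - m) + e1 m p q ^+ 2.

(* The product of the pairwise sums of [m, m, m + p, m + q], where [N = 2 m]. *)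
Definition pair_sums (N p q : rat) :=
  N * (N + p) ^+ 2 * (N + q) ^+ 2 * (N + p + q).

Lemma certE m p q x :
  - pair_sums (2 * m) p q * (2 * m - 2 * x)
  = e1 m p q * (e1 m p q - 1) * ((2 * m - 1 - 2 * x) * quartic p q (2 * m - x))
    + (cert m p q (x + 1) * quartic p q (2 * m - x) - cert m p q x * quartic p q x).
Proof. by rewrite /pair_sums /cert /quartic /e1; ring. Qed.

(** The derivative of [certE] in [x], needed because [dterm] takes a value together with its
    derivative. *)
Lemma cert'E m p q x :
  - pair_sums (2 * m) p q * (- 2)
  = e1 m p q * (e1 m p q - 1)
    * (- 2 * quartic p q (2 * m - x) - (2 * m - 1 - 2 * x) * quartic' p q (2 * m - x))
    + (cert' m p q (x + 1) * quartic p q (2 * m - x)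
       - cert m p q (x + 1) * quartic' p q (2 * m - x)
       - (cert' m p q x * quartic p q x + cert m p q x * quartic' p q x)).
Proof. by rewrite /pair_sums /cert' /cert /quartic /quartic' /e1; ring. Qed.

Definition dsum p q n : rat :=
  \sum_(0 <= k < n.+1) dterm p q n k (n%:R - 2 * k%:R) (- 2).

Lemma dsumS p q n :
  - pair_sums n.+1%:R p%:R q%:R * dsum p q n.+1 =
  (2 * n + p + q).+1%:R * (2 * n + p + q).+2%:R * dsum p q n.
Proof.
pose m : rat := n.+1%:R / 2.
have m2 : n.+1%:R = 2 * m by rewrite /m; field.
have n2 : n%:R = 2 * m - 1 by rewrite -m2 -natr1; ring.
have -> : (2 * n + p + q).+1%:R * (2 * n + p + q).+2%:R
  = e1 m p%:R q%:R * (e1 m p%:R q%:R - 1).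
  rewrite -[(2 * n + p + q).+2%:R]natr1 -[(2 * n + p + q).+1%:R]natr1 !natrD.
  by rewrite n2 /e1; ring.
pose v k := cert m p%:R q%:R k%:R; pose v' k := cert' m p%:R q%:R k%:R.
(* The sum of the certificate at [k.+1] over level [n] is lifted to level [n.+1] in two ways; their
   equality is the telescoping. *)
have eqv := sum_dterm_upS p q n v v'.
rewrite (sum_dterm_up p q n (fun k => v k.+1) (fun k => v' k.+1)) in eqv.
rewrite /dsum (sum_dterm_up p q n (fun k => n%:R - 2 * k%:R) (fun=> - 2)).
rewrite -[RHS]addr0 -[X in _ = _ + X](subrr (\sum_(0 <= k < n.+2)
     dterm p q n.+1 k (v k * quartic p%:R q%:R k%:R)
       (v' k * quartic p%:R q%:R k%:R + v k * quartic' p%:R q%:R k%:R))).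
rewrite -{1}eqv -sumrB !mulr_sumr -big_split /=; apply: eq_bigr => k _.
rewrite -!dtermZ -dtermB /v /v' m2 n2 -[k.+1%:R]natr1 (certE m p%:R q%:R k%:R).
by rewrite (cert'E m p%:R q%:R k%:R) dtermD.
Qed.

Lemma dsumE p q n :
  dsum p q n = - 2 * (-1) ^+ n * (2 * n + p + q)`!%:R
    / (n`!%:R * (n + p)`!%:R ^+ 2 * (n + q)`!%:R ^+ 2 * (n + p + q)`!%:R).
Proof.
elim: n => [|n IHn].
  rewrite /dsum big_nat1 /dterm /inv_fact4 muln0 !addn0 !add0n fact0.
  by field; rewrite !fact_neq0.
have pair_neq0 : pair_sums n.+1%:R p%:R q%:R != 0.
  by rewrite /pair_sums -!natrD -!natrX -!natrM pnatr_eq0.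
have -> : dsum p q n.+1 =
    - ((2 * n + p + q).+1%:R * (2 * n + p + q).+2%:R * dsum p q n)
    / pair_sums n.+1%:R p%:R q%:R.
  by rewrite -dsumS !mulNr opprK mulrC mulKf.
rewrite IHn mulnS !addSn add0n !factS !natrM [_ ^+ n.+1]exprS.
have -> : pair_sums n.+1%:R p%:R q%:R =
    n.+1%:R * (n + p).+1%:R ^+ 2 * (n + q).+1%:R ^+ 2 * (n + p + q).+1%:R.
  by rewrite /pair_sums -!natrD !addSn.
field.
by rewrite !fact_neq0 ?nat1r -?natrD ?nat1r !pnatr_eq0.
Qed.

Lemma sum_antisym n (f g : nat -> rat) :
  (forall k, (k <= n)%N -> f (n - k)%N = - f k) ->
  \sum_(0 <= k < n.+1) f k * g k
  = 2^-1 * \sum_(0 <= k < n.+1) f k * (g k - g (n - k)%N).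
Proof.
move=> fN.
have rev : \sum_(0 <= k < n.+1) f k * g (n - k)%N = - \sum_(0 <= k < n.+1) f k * g k.
  rewrite big_nat_rev /= -sumrN !big_nat; apply: eq_bigr => k /andP[_ lt_kn].
  by rewrite add0n subSS subKn // fN // mulNr.
rewrite [X in _ * X](eq_bigr (fun k => f k * g k - f k * g (n - k)%N)).
  by rewrite sumrB rev; field.
by move=> k _; ring.
Qed.

(** The factor split off does not depend on [k]; what remains is symmetric under [k -> n - k]. *)
Lemma bin_ratioE p q n k : (k <= n)%N ->
  'C(n, k)%:R ^+ 2 * (('C(n + p, k)%:R * 'C(n + q, k)%:R)
    / ('C(k + p, k)%:R * 'C(k + q, k)%:R))
  = n`!%:R ^+ 2 * (n + p)`!%:R * (n + q)`!%:R * p`!%:R * q`!%:R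
    * (inv_fact4 p q k * inv_fact4 p q (n - k)) :> rat.
Proof.
move=> le_kn; have le_knD r : (k <= n + r)%N by rewrite (leq_trans le_kn) ?leq_addr.
rewrite !bin_factr ?leq_addr ?le_knD // /inv_fact4 !addKn.
rewrite !(addnC _ k) !addnBA // ?(addnC _ n).
by field; rewrite ?fact_neq0.
Qed.

Lemma sum_dterm_harmonic4 p q n :
  \sum_(0 <= k < n.+1)
     inv_fact4 p q k * inv_fact4 p q (n - k)
     * (1 + (n%:R - 2 * k%:R) * harmonic4 p q k)
  = - 2^-1 * dsum p q n.
Proof.
pose w k := inv_fact4 p q k * inv_fact4 p q (n - k).
pose f k := w k * (n%:R - 2 * k%:R).
have fN k : (k <= n)%N -> f (n - k)%N = - f k.
  by move=> le_kn; rewrite /f /w subKn // natrB //; ring.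
rewrite (eq_bigr (fun k => w k + f k * harmonic4 p q k)); last first.
  by move=> k _; rewrite /f /w; ring.
(* As [f] is odd under [k -> n - k], only half the difference of [harmonic4] at [k] and [n - k]
   survives, as in [dterm]. *)
rewrite big_split /= (sum_antisym _ _ _ fN) /dsum !mulr_sumr -big_split /=.
by apply: eq_bigr => k _; rewrite /dterm /f /w; field.
Qed.

Theorem theorem7 (n b d : nat) :
  \sum_(0 <= k < n.+1)
     ('C(n, k)%:R ^+ 2
      * (('C(n + b * n, k)%:R * 'C(n + d * n, k)%:R)
         / ('C(k + b * n, k)%:R * 'C(k + d * n, k)%:R))
      * (1 + (n%:R - 2 * k%:R)
             * (2 * harmonic k + harmonic (b * n + k) + harmonic (d * n + k))))
  = (-1) ^+ n * ('C(2 * n + b * n + d * n, n)%:R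
                 / ('C(n + b * n, n)%:R * 'C(n + d * n, n)%:R)) :> rat.
Proof.
(* The recurrence in [n] holds for fixed [p] and [q], so their dependence on [n] is dropped. *)
move: (b * n)%N (d * n)%N => p q.
pose c : rat := n`!%:R ^+ 2 * (n + p)`!%:R * (n + q)`!%:R * p`!%:R * q`!%:R.
transitivity (c * (- 2^-1 * dsum p q n)).
  rewrite -sum_dterm_harmonic4 mulr_sumr !big_nat.
  apply: eq_bigr => k /andP[_ lt_kn].
  by rewrite bin_ratioE // /c /harmonic4; ring.
have le_n : (n <= 2 * n + p + q)%N by lia.
rewrite dsumE !bin_factr ?leq_addr // !addKn.
rewrite (_ : 2 * n + p + q - n = n + p + q)%N; last by lia.
by rewrite /c; field; rewrite !fact_neq0.
Qed.
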